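(* Let $p$ be a prime and let $G,H$ be finite $p$-groups with $|G'|=|H'|=p$. Write $|G:Z(G)|=p^{2n}$ and $|H:Z(H)|=p^{2m}$. Then the following are equivalent: 1. $G$ and $H$ are isoclinic; 2. $n=m$ (equivalently $|G:Z(G)|=|H:Z(H)|$); 3. $P_2(G)=P_2(H)$; 4. $P_3(G)=P_3(H)$. In this case $P_r(G)=P_r(H)$ for all $r\ge 2$. Moreover, the parameter $n$ (and hence the isoclinism class) is recovered from $P_2(G)$ and $P_3(G)$ by $$p^{2n}=\frac{p-1}{pP_2(G)-1}=\frac{p^3-1}{p^3P_3(G)-1}.$$
   Context: For a finite group $G$ and $r\ge 1$, $P_r(G):=|\{(x_1,\dots,x_r)\in G^r : x_ix_j=x_jx_i\ \text{for all } i,j\}|/|G|^r$. $G'$ is the commutator subgroup and $Z(G)$ the center. For a finite $p$-group with $|G'|=p$, the index $|G:Z(G)|$ is always of the form $p^{2n}$ with $n\ge1$. Two groups $G,H$ are isoclinic if there exist isomorphisms $\phi:G/Z(G)\to H/Z(H)$ and $\psi:G'\to H'$ intertwining the commutator maps: $\psi\circ\kappa_G=\kappa_H\circ(\phi\times\phi)$, where $\kappa_G:(G/Z(G))^2\to G'$ is the well-defined map $(gZ(G),hZ(G))\mapsto[g,h]$, and similarly $\kappa_H$. *)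

(* Defs.v *)
From HB Require Import structures.
From mathcomp Require Import all_boot all_order all_algebra all_fingroup all_solvable.

Set Implicit Arguments.
Unset Strict Implicit.
Unset Printing Implicit Defensive.

Import GroupScope GRing.Theory.

Definition commuting_tuples (gT : finGroupType) (r : nat) (G : {group gT})
    : {set {ffun 'I_r -> gT}} :=
  [set x in ffun_on G | [forall i, forall j, x i * x j == x j * x i]].

Definition commuting_prob (gT : finGroupType) (r : nat) (G : {group gT}) : rat :=
  (#|commuting_tuples r G|%:R / #|G|%:R ^+ r)%R.

(* MathComp's convention is [~ x, y] = x^-1 * y^-1 * x * y. With the other
   convention, x * y * x^-1 * y^-1, the value at (a, b) is kappa G a^-1 b^-1,
   so [isoclinic] below does not depend on this choice. *)
Definition kappa (gT : finGroupType) (G : {group gT})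
    (a b : coset_of 'Z(G)) : gT := [~ repr a, repr b].

Lemma kappaE (gT : finGroupType) (G : {group gT}) (x y : gT) :
  x \in G -> y \in G ->
  kappa (coset 'Z(G) x) (coset 'Z(G) y) = [~ x, y].
Proof.
have nZ u : u \in G -> u \in 'N('Z(G)) by apply/subsetP/gFnorm.
have rZ u : u \in G -> exists2 z, z \in 'Z(G) & repr (coset 'Z(G) u) = z * u.
  move=> Gu; have := mem_repr_coset (coset 'Z(G) u).
  by rewrite val_coset ?nZ //; case/rcosetP=> z Zz ->; exists z.
move=> Gx Gy; rewrite /kappa.
have [z /centerP[Gz cz] ->] := rZ x Gx; have [t /centerP[Gt ct] ->] := rZ y Gy.
have zyt : [~ z, t * y] = 1 by apply/eqP/commgP/cz/groupM.
have xt : [~ x, t] = 1 by apply/eqP/commgP/commute_sym/ct.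
by rewrite commMgJ zyt conj1g mul1g commgMJ xt conj1g mulg1.
Qed.

Definition isoclinic (gT hT : finGroupType)
    (G : {group gT}) (H : {group hT}) : Prop :=
  exists (phi : {morphism (G / 'Z(G)) >-> coset_of 'Z(H)})
         (psi : {morphism G^`(1) >-> hT}),
    [/\ isom (G / 'Z(G)) (H / 'Z(H)) phi,
        isom G^`(1) H^`(1) psi
      & {in G / 'Z(G) &, forall a b, psi (kappa a b) = kappa (phi a) (phi b)}].

(* Main.v *)
Require Import Defs.
From mathcomp Require Import all_boot all_order all_algebra all_fingroup all_solvable.
From mathcomp Require Import ring.

(** Everything about a finite p-group G with |G'| = p that matters here is
    governed by the index |G : Z(G)|.

    Probabilities. G' is central, so for a fixed g the map x |-> [x, g] is a
    homomorphism into a group of order p, and it is onto or trivial: this is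
    [index_subcent1]. Used twice it shows that, for x outside Z(G), the
    subgroup C = C_G(x) has index p in G and a center p times larger than Z(G)
    ([card_center_subcent1]), so that passing from G to C multiplies the ratio
    t = |Z(G)| / |G| by p^2. Conditioning a commuting (r+1)-tuple on its first
    entry x leaves a commuting r-tuple of C_G(x) ([commuting_probS]). Hence
    P_r(G) = f_r(t), where f_0 = 1 and
      f_{r+1}(t) = t f_r(t) + (1 - t) f_r(p^2 t) / p^r
    ([commuting_prob_der_central]); here C' may be trivial, which is why the
    hypothesis carried through the induction is that |G'| divides p. For
    r = 2, 3 this gives p^k P_r(G) - 1 = (p^k - 1) t with k = 1, 3, so each of
    P_2(G) and P_3(G) determines t = p^(-2n), whereas n determines every
    P_r(G).

    Isoclinism. The commutator map on V = G / Z(G) is an alternating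
    bimultiplicative form with values in the group G' of order p, and it is
    nondegenerate since only the center has been factored out
    ([kappa_symplectic]). As over a field with p elements, such forms are
    classified by |V|: if b(u, v) <> 1 then V = W x <u> x <v> with W the
    orthogonal of u and v, and W is again nondegenerate ([symp_split]). Peeling
    off such hyperbolic pairs simultaneously on two spaces of the same order,
    with the same value b(u, v) on both sides, produces an isometry
    ([symp_isometry]); this is the required isomorphism of central quotients
    once G' and H' have been identified. Conversely, isoclinic groups have
    isomorphic central quotients. *)

Import GroupScope GRing.Theory.

Set Implicit Arguments.
Unset Strict Implicit.

(** * Commuting tuples, one entry at a time *)

Section CommutingTuples.
Variable gT : finGroupType.
Implicit Types (G : {group gT}).

Definition ffun_cons r (x : gT) (t : {ffun 'I_r -> gT}) : {ffun 'I_r.+1 -> gT} :=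
  [ffun i => if unlift ord0 i is Some j then t j else x].

Lemma ffun_cons0 r x (t : {ffun 'I_r -> gT}) : ffun_cons x t ord0 = x.
Proof. by rewrite ffunE unlift_none. Qed.

Lemma ffun_consS r x (t : {ffun 'I_r -> gT}) j :
  ffun_cons x t (lift ord0 j) = t j.
Proof. by rewrite ffunE liftK. Qed.

Lemma commuting_tuplesP r G (t : {ffun 'I_r -> gT}) :
  reflect ((forall i, t i \in G) /\ (forall i j, commute (t i) (t j)))
          (t \in commuting_tuples r G).
Proof.
rewrite inE; apply: (iffP andP) => [[/ffun_onP Gt /forallP ct]|[Gt ct]]; split=> //.
- by move=> i j; apply/eqP; move/forallP: (ct i).
- by apply/ffun_onP.
- by apply/forallP=> i; apply/forallP=> j; apply/eqP/ct.
Qed.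

Lemma ffun_cons_inj r x : injective (@ffun_cons r x).
Proof.
move=> t u /ffunP e; apply/ffunP=> j.
by rewrite -(ffun_consS x t) e ffun_consS.
Qed.

Lemma fiber_commuting_tuples r G x : x \in G ->
  [set t in commuting_tuples r.+1 G | t ord0 == x]
    = ffun_cons x @: commuting_tuples r 'C_G[x].
Proof.
move=> Gx; apply/setP=> t; rewrite inE; apply/andP/imsetP.
  case=> /commuting_tuplesP[Gt ct] /eqP t0.
  exists [ffun j => t (lift ord0 j)].
    apply/commuting_tuplesP; split=> [i|i j]; rewrite !ffunE ?ct //.
    by rewrite inE Gt /=; apply/cent1P; rewrite -t0; apply: ct.
  apply/ffunP=> i; case: (unliftP ord0 i) => [j ->|->].
    by rewrite ffun_consS ffunE.
  by rewrite ffun_cons0.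
case=> u /commuting_tuplesP[Cu cu] ->; rewrite ffun_cons0 eqxx; split=> //.
have cxu j : u j \in G /\ commute x (u j).
  by have:= Cu j; rewrite inE => /andP[-> /cent1P].
apply/commuting_tuplesP; split=> [i|i j].
  case: (unliftP ord0 i) => [k ->|->]; rewrite ?ffun_consS ?ffun_cons0 //.
  by case: (cxu k).
case: (unliftP ord0 i) => [k ->|->]; case: (unliftP ord0 j) => [l ->|->];
  rewrite ?ffun_consS ?ffun_cons0 //.
- by apply/commute_sym; case: (cxu k).
- by case: (cxu l).
Qed.

Lemma card_commuting_tuplesS r G :
  #|commuting_tuples r.+1 G| = (\sum_(x in G) #|commuting_tuples r 'C_G[x]|)%N.
Proof.
rewrite -sum1_card (partition_big (fun t : {ffun _} => t ord0) (mem G)) /=; last first.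
  by move=> t /commuting_tuplesP[Gt _].
apply: eq_bigr => x Gx.
rewrite -(card_imset _ (@ffun_cons_inj r x)) -fiber_commuting_tuples // -sum1_card.
by apply: eq_bigl => t; rewrite !inE.
Qed.

Lemma card_commuting_tuples0 G : #|commuting_tuples 0 G| = 1%N.
Proof.
rewrite (_ : commuting_tuples 0 G = setT) ?cardsT ?card_ffun ?card_ord ?expn0 //.
apply/setP=> t; rewrite in_setT; apply/commuting_tuplesP; split; by case.
Qed.

Local Open Scope ring_scope.

Lemma natr_card_neq0 G : #|G|%:R != 0 :> rat.
Proof. by rewrite Num.Theory.pnatr_eq0 -lt0n cardG_gt0. Qed.

Lemma commuting_prob0 G : commuting_prob 0 G = 1.
Proof. by rewrite /commuting_prob card_commuting_tuples0 expr0 divr1. Qed.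

(** The tuples whose first entry is x are those of C_G(x), which is smaller than
    G by the factor |G : C_G(x)| in each of the r remaining entries. *)
Lemma commuting_probS r G :
  commuting_prob r.+1 G =
  (\sum_(x in G) commuting_prob r 'C_G[x] / #|G : 'C_G[x]|%:R ^+ r) / #|G|%:R.
Proof.
rewrite /commuting_prob card_commuting_tuplesS natr_sum exprSr invfM [in LHS]mulrA.
congr (_ / _); rewrite mulr_suml; apply: eq_bigr => x Gx.
have /(congr1 (fun k => k%:R : rat)) := Lagrange (subsetIl G 'C[x]).
rewrite natrM => <-; rewrite exprMn invfM mulrA //.
Qed.

End CommutingTuples.

(** * Centralizers in a group with a small central derived subgroup *)

Section CentralDerived.
Variables (gT : finGroupType) (p : nat).
Implicit Types (A G : {group gT}).
Hypothesis p_pr : prime p.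

Lemma commgM_der_central G : G^`(1) \subset 'Z(G) ->
  {in G & &, forall x y z, [~ x * y, z] = [~ x, z] * [~ y, z]}.
Proof.
move=> sG'Z x y z Gx Gy Gz; rewrite commMgJ; congr (_ * _).
apply/conjg_fixP/commgP.
have /(subsetP sG'Z)/centerP[_ cZ] : [~ x, z] \in G^`(1) by apply: mem_commg.
exact: cZ.
Qed.

Lemma commgMr_der_central G : G^`(1) \subset 'Z(G) ->
  {in G & &, forall x y z, [~ x, y * z] = [~ x, y] * [~ x, z]}.
Proof.
move=> sG'Z x y z Gx Gy Gz.
rewrite -invgR (commgM_der_central sG'Z) // invMg !invgR.
have /(subsetP sG'Z)/centerP[_ cZ] : [~ x, z] \in G^`(1) by apply: mem_commg.
by apply: cZ; rewrite groupR.
Qed.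

(** The kernel of a |-> [a, g] on A is C_A(g); the image is a nontrivial subgroup
    of G', whose order is 1 or p. *)
Lemma index_subcent1 G A g :
    G^`(1) \subset 'Z(G) -> #|G^`(1)| %| p ->
    A \subset G -> g \in G -> g \notin 'C(A) ->
  #|A : 'C_A[g]| = p.
Proof.
move=> sG'Z dvG' sAG Gg nCg.
have fM : {in A &, {morph (fun a => [~ a, g]) : x y / x * y}}.
  by move=> x y Ax Ay; rewrite /= (commgM_der_central sG'Z) //; apply: (subsetP sAG).
pose f := Morphism fM.
have kf : 'ker f = 'C_A[g].
  apply/setP=> a; rewrite !in_setI; apply: andb_id2l => Aa.
  rewrite [LHS]inE [LHS]inE /=.
  by apply/commgP/cent1P.
have sfG' : f @* A \subset G^`(1).
  by apply/subsetP=> _ /morphimP[a _ Aa ->]; rewrite mem_commg // ?(subsetP sAG).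
have -> : #|A : 'C_A[g]| = #|f @* A| by rewrite card_morphim kf setIid.
have: #|f @* A| %| p by apply: dvdn_trans dvG'; apply: cardSg.
have [_ dvp] := primeP p_pr; case/dvp/orP=> /eqP // /card1_trivg f1.
case/negP: nCg; apply/centP=> a Aa; apply/commute_sym/commgP.
have: f a \in f @* A by apply: mem_morphim.
by rewrite f1 => /set1P /= ->.
Qed.

(** Choose g outside C = C_G(x). It does not centralize Z(C), which contains x,
    so C_{Z(C)}(g) has index p in Z(C). An element of Z(C) commuting with g has a
    centralizer strictly larger than C, hence all of G as C has prime index:
    therefore C_{Z(C)}(g) = Z(G). *)
Lemma card_center_subcent1 G x :
    G^`(1) \subset 'Z(G) -> #|G^`(1)| %| p -> x \in G -> x \notin 'Z(G) ->
  #|'Z('C_G[x])| = (p * #|'Z(G)|)%N.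
Proof.
move=> sG'Z dvG' Gx nZx.
have nCx : x \notin 'C(G) by move: nZx; rewrite inE Gx.
have iC : #|G : 'C_G[x]| = p by apply: (index_subcent1 sG'Z).
have /subsetPn[g Gg nCg] : ~~ (G \subset 'C[x]) by rewrite -cent_set1 centsC sub1set.
have ngC : g \notin 'C_G[x] by rewrite inE Gg.
have Zx : x \in 'Z('C_G[x]).
  by rewrite inE inE Gx cent1id; apply/centP=> y /setIP[_ /cent1P].
have sZG : 'Z('C_G[x]) \subset G by apply: subset_trans (center_sub _) (subsetIl _ _).
have iZ : #|'Z('C_G[x]) : 'C_('Z('C_G[x]))[g]| = p.
  apply: (index_subcent1 sG'Z) => //.
  apply: contra nCg => /centP/(_ x Zx) cgx; exact/cent1P.
rewrite -(Lagrange (subsetIl 'Z('C_G[x]) 'C[g])) iZ mulnC; congr (p * _)%N.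
apply: eq_card => y; apply/idP/idP.
  case/setIP=> Zy /cent1P cgy; have Gy := subsetP sZG _ Zy.
  rewrite inE Gy; apply: contraT => nCy.
  (* If y were not central, C_G(y) would have the same index as C_G(x). *)
  have iy : #|G : 'C_G[y]| = p by apply: (index_subcent1 sG'Z).
  have sC : 'C_G[x] \subset 'C_G[y].
    apply/subsetP=> z Cz; have [Gz _] := setIP Cz; rewrite inE Gz.
    by apply/cent1P/commute_sym; have /centerP[_] := Zy; apply.
  have /eqP eC : 'C_G[x] == 'C_G[y] :> {set gT}.
    rewrite eqEcard sC /= -(leq_pmul2r (prime_gt0 p_pr)) -{1}iy -iC.
    by rewrite !Lagrange ?subsetIl // leqnn.
  by case/negP: ngC; rewrite eC inE Gg; apply/cent1P.
case/centerP=> Gy cy.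
rewrite inE; apply/andP; split; last by apply/cent1P/cy.
apply/centerP; split; first by rewrite inE Gy; apply/cent1P/cy.
by move=> z /setIP[Gz _]; apply: cy.
Qed.

Local Open Scope ring_scope.

(** The value of P_r(G) as a function of t = |Z(G)| / |G|: the first entry of the
    tuple is central with probability t, and otherwise the s remaining ones must
    fall in a centralizer of index q, where the ratio t has become q^2 t. *)
Fixpoint central_prob (q : rat) r (t : rat) : rat :=
  if r is s.+1 then
    t * central_prob q s t + (1 - t) * (central_prob q s (q ^+ 2 * t) / q ^+ s)
  else 1.

(** The hypothesis on |G'| is a divisibility because the induction applies to
    centralizers, which may be abelian. *)
Lemma commuting_prob_der_central r G :
    (G^`(1) \subset 'Z(G))%g -> (#|G^`(1)%g| %| p)%N ->
  commuting_prob r G = central_prob p%:R r (#|'Z(G)|%:R / #|G|%:R).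
Proof.
elim: r G => [|r IHr] G sG'Z dvG'; first by rewrite commuting_prob0.
have G0 := natr_card_neq0 G.
have p0 : p%:R != 0 :> rat by rewrite Num.Theory.pnatr_eq0 -lt0n prime_gt0.
rewrite commuting_probS (big_setID 'Z(G)) /= (setIidPr (center_sub G)).
have -> : \sum_(x in 'Z(G)) commuting_prob r 'C_G[x] / #|G : 'C_G[x]|%:R ^+ r
   = #|'Z(G)|%:R * commuting_prob r G.
  rewrite -sum1_card natr_sum mulr_suml; apply: eq_bigr => x /centerP[Gx cx].
  have eC : 'C_G[x]%g = G by apply/setIidPl/subsetP=> y Gy; apply/cent1P/commute_sym/cx.
  have eCG : 'C_G[x]%G = G by apply: group_inj.
  by rewrite eCG eC indexgg expr1n divr1 mul1r.
have -> : \sum_(x in G :\: 'Z(G)) commuting_prob r 'C_G[x] / #|G : 'C_G[x]|%:R ^+ r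
   = (#|G|%:R - #|'Z(G)|%:R) *
     (central_prob p%:R r (p%:R ^+ 2 * (#|'Z(G)|%:R / #|G|%:R)) / p%:R ^+ r).
  rewrite -natrB ?subset_leq_card ?center_sub //.
  have <- : #|G :\: 'Z(G)| = (#|G| - #|'Z(G)|)%N.
    by rewrite cardsD (setIidPr (center_sub G)).
  rewrite -sum1_card natr_sum mulr_suml.
  apply: eq_bigr => x /setDP[Gx nZx]; rewrite mul1r.
  have nCx : x \notin 'C(G) by move: nZx; rewrite inE Gx.
  have iC : #|G : 'C_G[x]| = p by apply: (index_subcent1 sG'Z).
  have sC'G' : ('C_G[x]^`(1) \subset G^`(1))%g by apply: dergS; apply: subsetIl.
  rewrite iC IHr.
  - rewrite card_center_subcent1 // natrM.
    have /(congr1 (fun k => k%:R : rat)) := Lagrange (subsetIl G 'C[x]).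
    rewrite iC natrM => <-; congr (central_prob _ _ _ / _).
    have C0 := natr_card_neq0 'C_G[x]%G.
    by field; rewrite p0 C0.
  - apply/subsetP=> y C'y; have := subsetP (subset_trans sC'G' sG'Z) _ C'y.
    case/centerP=> Gy cy; apply/centerP; split; first exact: (subsetP (der_sub 1 _)).
    by move=> z /setIP[Gz _]; apply: cy.
  - exact: dvdn_trans (cardSg sC'G') dvG'.
rewrite IHr //=.
by rewrite mulrDl mulrAC [_ * _ / #|G|%:R]mulrAC mulrBl divff.
Qed.

Lemma central_prob2 q t : q != 0 -> q * central_prob q 2 t - 1 = (q - 1) * t.
Proof. by move=> q0 /=; field. Qed.

Lemma central_prob3 q t :
  q != 0 -> q ^+ 3 * central_prob q 3 t - 1 = (q ^+ 3 - 1) * t.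
Proof. by move=> q0 /=; field. Qed.

Lemma center_ratio G :
  #|'Z(G)|%:R / #|G|%:R = #|G : 'Z(G)|%g%:R^-1 :> rat.
Proof.
rewrite -(Lagrange (center_sub G)) natrM invfM mulrA divff ?mul1r //.
exact: (natr_card_neq0 'Z(G)%G).
Qed.

Lemma index_center_prob2 G :
    (G^`(1) \subset 'Z(G))%g -> (#|G^`(1)%g| %| p)%N ->
  #|G : 'Z(G)|%g%:R = (p%:R - 1) / (p%:R * commuting_prob 2 G - 1) :> rat.
Proof.
move=> sG'Z dvG'; have p0 : p%:R != 0 :> rat.
  by rewrite Num.Theory.pnatr_eq0 -lt0n prime_gt0.
have p1 : p%:R - 1 != 0 :> rat.
  by rewrite subr_eq0 (Num.Theory.eqr_nat _ p 1) gtn_eqF ?prime_gt1.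
rewrite commuting_prob_der_central // central_prob2 // center_ratio.
by rewrite invfM invrK mulrA divff ?mul1r.
Qed.

Lemma index_center_prob3 G :
    (G^`(1) \subset 'Z(G))%g -> (#|G^`(1)%g| %| p)%N ->
  #|G : 'Z(G)|%g%:R
    = (p%:R ^+ 3 - 1) / (p%:R ^+ 3 * commuting_prob 3 G - 1) :> rat.
Proof.
move=> sG'Z dvG'; have p0 : p%:R != 0 :> rat.
  by rewrite Num.Theory.pnatr_eq0 -lt0n prime_gt0.
have p1 : p%:R ^+ 3 - 1 != 0 :> rat.
  rewrite subr_eq0 -natrX (Num.Theory.eqr_nat _ _ 1) gtn_eqF //.
  by rewrite -(exp1n 3) ltn_exp2r ?prime_gt1.
rewrite commuting_prob_der_central // central_prob3 // center_ratio.
by rewrite invfM invrK mulrA divff ?mul1r.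
Qed.

End CentralDerived.

(** A nontrivial normal subgroup of a p-group meets the center, and one of prime
    order must then lie inside it. *)
Lemma pgroup_der_central (gT : finGroupType) (G : {group gT}) p :
  prime p -> p.-group G -> #|G^`(1)| = p -> G^`(1) \subset 'Z(G).
Proof.
move=> p_pr pG oG'; have G'_pr : prime #|G^`(1)| by rewrite oG'.
apply: prime_meetG => //; apply: meet_center_nil (pgroup_nil pG) (der_normal 1 G) _.
by rewrite -cardG_gt1 prime_gt1.
Qed.

(** * Alternating forms with values in a group of prime order *)

Lemma prime_cycle (gT : finGroupType) (C : {group gT}) c :
  prime #|C| -> c \in C -> c != 1 -> <[c]> = C.
Proof.
move=> C_pr Cc nc; apply/eqP; rewrite eqEsubset cycle_subG Cc /=.
apply: prime_meetG => //; apply: contra nc => /eqP C1.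
by rewrite -in_set1 -[[set 1]]C1 inE cycle_id Cc.
Qed.

(** An alternating nondegenerate bimultiplicative form. When |C| = p is prime,
    these axioms force V to be elementary abelian ([symp_abelian],
    [symp_expg]), so that this is a symplectic space over F_p in
    multiplicative notation. *)
Definition symplectic (gT cT : finGroupType) (V : {group gT}) (C : {group cT})
    (b : gT -> gT -> cT) : Prop :=
  [/\ {in V &, forall x y, b x y \in C},
      {in V & &, forall x y z, b (x * y) z = b x z * b y z},
      {in V & &, forall x y z, b x (y * z) = b x y * b x z},
      {in V, forall x, b x x = 1}
    & {in V, forall x, {in V, forall y, b x y = 1} -> x = 1}].

Section Form.
Variables (gT cT : finGroupType) (V : {group gT}) (C : {group cT}).
Variable b : gT -> gT -> cT.
Hypotheses (C_pr : prime #|C|) (sb : symplectic V C b).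

Let bC : {in V &, forall x y, b x y \in C}. Proof. by case: sb. Qed.
Let bMl : {in V & &, forall x y z, b (x * y) z = b x z * b y z}.
Proof. by case: sb. Qed.
Let bMr : {in V & &, forall x y z, b x (y * z) = b x y * b x z}.
Proof. by case: sb. Qed.
Let bxx : {in V, forall x, b x x = 1}. Proof. by case: sb. Qed.
Let b_inj : {in V, forall x, {in V, forall y, b x y = 1} -> x = 1}.
Proof. by case: sb. Qed.

Lemma symp1l : {in V, forall y, b 1 y = 1}.
Proof. by move=> y Vy; apply: (mulgI (b 1 y)); rewrite -bMl ?mulg1. Qed.

Lemma symp1r : {in V, forall y, b y 1 = 1}.
Proof. by move=> y Vy; apply: (mulgI (b y 1)); rewrite -bMr ?mulg1. Qed.

Lemma sympXl x y i : x \in V -> y \in V -> b (x ^+ i) y = b x y ^+ i.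
Proof.
by move=> Vx Vy; elim: i => [|i IHi]; rewrite ?symp1l // !expgS bMl ?IHi ?groupX.
Qed.

Lemma sympXr x y i : x \in V -> y \in V -> b x (y ^+ i) = b x y ^+ i.
Proof.
by move=> Vx Vy; elim: i => [|i IHi]; rewrite ?symp1r // !expgS bMr ?IHi ?groupX.
Qed.

(** Expand b (xy) (xy) = 1. *)
Lemma symp_anti : {in V &, forall x y, b y x = (b x y)^-1}.
Proof.
move=> x y Vx Vy; apply/eqP; rewrite eq_sym eq_invg_mul; apply/eqP.
have := bxx (groupM Vx Vy).
by rewrite bMl ?groupM // !bMr // !bxx // mul1g mulg1.
Qed.

Lemma symp_commute x y x' y' : x \in V -> y \in V -> x' \in V -> y' \in V ->
  commute (b x y) (b x' y').
Proof.
move=> Vx Vy Vx' Vy'; apply: (centsP (cyclic_abelian (prime_cyclic C_pr))).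
  exact: bC.
exact: bC.
Qed.

(** b [x, y] z = 1 for all z because the values of b commute. *)
Lemma symp_abelian : abelian V.
Proof.
apply/centsP=> x Vx y Vy; apply/commgP/eqP/b_inj; first by rewrite groupR.
move=> z Vz; apply: (mulgI (b (y * x) z)).
rewrite -bMl ?groupR //; last exact: groupM.
rewrite -commgC mulg1 !bMl //.
exact: symp_commute.
Qed.

Lemma symp_expg x : x \in V -> x ^+ #|C| = 1.
Proof.
move=> Vx; apply: b_inj; first exact: groupX.
by move=> y Vy; rewrite sympXl // expg_cardG ?bC.
Qed.

Lemma symp_order x : x \in V -> x != 1 -> #[x] = #|C|.
Proof.
move=> Vx nx; have: #[x] %| #|C| by rewrite order_dvdn symp_expg.
have [_ dvC] := primeP C_pr; case/dvC/orP=> /eqP // ox1.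
by rewrite -order_eq1 ox1 in nx.
Qed.

Lemma symp_neq1 x : x \in V -> x != 1 -> exists2 y, y \in V & b x y != 1.
Proof.
move=> Vx nx; apply/exists_inP; apply: contraR nx.
rewrite negb_exists_in => /forall_inP bx; apply/eqP/b_inj => // y Vy.
by apply/eqP; rewrite -[_ == _]negbK bx.
Qed.

Lemma symp_surj x c : x \in V -> x != 1 -> c \in C ->
  exists2 y, y \in V & b x y = c.
Proof.
move=> Vx nx; have [y Vy nb] := symp_neq1 Vx nx.
rewrite -(prime_cycle C_pr (bC Vx Vy) nb) => /cycleP[i ->].
by exists (y ^+ i); rewrite ?groupX ?sympXr.
Qed.

(** W is the orthogonal of u and v. With c = b u v generating C, an x such that
    b x v = c^i and b u x = c^j agrees with u^i v^j on u and on v, which gives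
    its component in W. An element of W orthogonal to W is then orthogonal to V,
    so the form stays nondegenerate on W. *)
Lemma symp_split u v : u \in V -> v \in V -> b u v != 1 ->
  exists W : {group gT}, [/\ symplectic W C b, W \x (<[u]> \x <[v]>) = V,
    {in W, forall w, b w u = 1} & {in W, forall w, b w v = 1}].
Proof.
move=> Vu Vv nb; set c := b u v in nb.
have Cc : c \in C by apply: bC.
have gC a : a \in C -> exists i, a = c ^+ i.
  by move=> Ca; apply/cycleP; rewrite (prime_cycle C_pr).
have ortho_group : group_set [set w in V | (b w u == 1) && (b w v == 1)].
  apply/group_setP; split; first by rewrite inE group1 !symp1l ?eqxx.
  move=> x y; rewrite !inE => /and3P[Vx /eqP xu /eqP xv] /and3P[Vy /eqP yu /eqP yv].
  by rewrite groupM // !bMl // xu xv yu yv mulg1 eqxx.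
pose W := Group ortho_group.
have WP w : w \in W -> [/\ w \in V, b w u = 1 & b w v = 1].
  by rewrite inE => /and3P[-> /eqP-> /eqP->].
have sWV : W \subset V by apply/subsetP=> w /WP[].
have abV x y : x \in V -> y \in V -> commute x y.
  by move=> Vx Vy; apply: (centsP symp_abelian).
have vu : b v u = c^-1 by apply: symp_anti.
have decomp x : x \in V -> exists w i j, w \in W /\ x = w * (u ^+ i * v ^+ j).
  move=> Vx; have [i xv] := gC _ (bC Vx Vv); have [j xu] := gC _ (bC Vu Vx).
  have Vuv : u ^+ i * v ^+ j \in V by rewrite groupM ?groupX.
  exists (x * (u ^+ i * v ^+ j)^-1), i, j; split; last by rewrite mulgKV.
  have E z : z \in V -> b x z = b (u ^+ i * v ^+ j) z ->
     b (x * (u ^+ i * v ^+ j)^-1) z = 1.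
    move=> Vz e; apply: (mulIg (b (u ^+ i * v ^+ j) z)).
    rewrite -bMl //; [by rewrite mulgKV mul1g | by rewrite groupM ?groupV].
  rewrite inE groupM ?groupV //=; apply/andP; split; apply/eqP/E => //.
    rewrite bMl ?groupX // !sympXl // bxx // vu expg1n mul1g.
    by rewrite (symp_anti Vu Vx) xu expgVn.
  by rewrite bMl ?groupX // !sympXl // bxx // expg1n mulg1.
have ou i : c ^+ i = 1 -> u ^+ i = 1 /\ v ^+ i = 1.
  have oc : #[c] = #|C| by rewrite orderE (prime_cycle C_pr).
  move/eqP; rewrite -order_dvdn oc => /dvdnP[k ->].
  by rewrite mulnC !expgM !symp_expg // !expg1n.
exists W; split.
- split.
  + by move=> x y /WP[Vx _ _] /WP[Vy _ _]; apply: bC.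
  + by move=> x y z /WP[Vx _ _] /WP[Vy _ _] /WP[Vz _ _]; apply: bMl.
  + by move=> x y z /WP[Vx _ _] /WP[Vy _ _] /WP[Vz _ _]; apply: bMr.
  + by move=> x /WP[Vx _ _]; apply: bxx.
  + move=> x /WP[Vx xu xv] bxW; apply: b_inj => // _ /decomp[w [i [j [Ww ->]]]].
    have [Vw _ _] := WP w Ww.
    by rewrite !bMr ?groupM ?groupX // !sympXr // xu xv bxW // !expg1n !mulg1.
- have cuv : <[v]> \subset 'C(<[u]>).
    apply/centsP=> _ /cycleP[i ->] _ /cycleP[j ->].
    by apply: abV; rewrite groupX.
  have duv : <[u]> \x <[v]> = <[u]> <*> <[v]>.
    rewrite dprodEY //.
    apply/trivgP/subsetP=> x /setIP[/cycleP[i ->] /cycleP[j e]]; rewrite inE.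
    have : b u (u ^+ i) = 1 by rewrite sympXr // bxx ?expg1n.
    by rewrite e sympXr // => /ou[_ ->].
  have sPV : <[u]> <*> <[v]> \subset V by rewrite join_subG !cycle_subG Vu.
  have PP x : x \in <[u]> <*> <[v]> -> exists i j, x = u ^+ i * v ^+ j.
    rewrite -(dprodW duv) => /mulsgP[_ _ /cycleP[i ->] /cycleP[j ->] ->].
    by exists i, j.
  rewrite duv dprodE.
  + apply/eqP; rewrite eqEsubset mul_subG //=; apply/subsetP=> x.
    move/decomp=> [w [i [j [Ww ->]]]].
    by rewrite mem_mulg // groupM ?groupX // mem_gen // inE cycle_id ?orbT.
  + apply/centsP=> x Px w Ww; apply: abV; first exact: (subsetP sPV).
    exact: (subsetP sWV).
  apply/trivgP/subsetP=> x /setIP[Wx /PP[i [j e]]]; rewrite inE.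
  have [Vx xu xv] := WP x Wx.
  move: xu; rewrite e bMl ?groupX // !sympXl // bxx // vu expg1n mul1g expgVn.
  move/eqP; rewrite invg_eq1 => /eqP/ou[_ vj].
  move: xv; rewrite e bMl ?groupX // !sympXl // bxx // expg1n mulg1 => /ou[ui _].
  by rewrite ui vj mulg1.
- by move=> w /WP[].
- by move=> w /WP[].
Qed.

Lemma symp_hyperbolicE u v w x i j k l :
    u \in V -> v \in V -> w \in V -> x \in V ->
    b w u = 1 -> b w v = 1 -> b x u = 1 -> b x v = 1 ->
  b (w * (u ^+ i * v ^+ j)) (x * (u ^+ k * v ^+ l))
    = b w x * (b u v ^+ (i * l) * (b u v)^-1 ^+ (j * k)).
Proof.
move=> Vu Vv Vw Vx wu wv xu xv.
have ux : b u x = 1 by rewrite (symp_anti Vx Vu) xu invg1.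
have vx : b v x = 1 by rewrite (symp_anti Vx Vv) xv invg1.
rewrite !bMl ?groupM ?groupX // !bMr ?groupM ?groupX //.
rewrite !sympXl ?groupX // !sympXr ?groupX //.
by rewrite wu wv ux vx !bxx // (symp_anti Vu Vv) !(expg1n, mulg1, mul1g) -!expgM
  [(l * i)%N]mulnC [(k * j)%N]mulnC.
Qed.

End Form.

Section Isometry.
Variables (gT hT cT : finGroupType) (C : {group cT}).
Variables (b : gT -> gT -> cT) (b' : hT -> hT -> cT).
Hypothesis C_pr : prime #|C|.

(** A form-preserving map is injective by nondegeneracy, hence onto by
    counting. *)
Lemma symp_preserving_isom (V : {group gT}) (V' : {group hT})
    (f : {morphism V >-> hT}) :
    symplectic V C b -> f @* V \subset V' -> #|V| = #|V'| ->
    {in V &, forall x y, b x y = b' (f x) (f y)} ->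
    symplectic V' C b' ->
  isom V V' f.
Proof.
move=> sb sfV oV bf sb'; have [_ _ _ _ b_inj] := sb.
have f_inj : 'injm f.
  apply/subsetP=> x /morphpreP[Vx /set1P fx]; apply/set1P/b_inj => // y Vy.
  by rewrite bf // fx (symp1l sb') // (subsetP sfV) ?mem_morphim.
apply/isomP; split=> //; apply/eqP.
by rewrite eqEcard sfV card_injm // oV leqnn.
Qed.

(** Given hyperbolic pairs (u, v) in V and (u', v') in V' with b u v = b' u' v',
    an isometry of their orthogonals extends by u |-> u' and v |-> v'. *)
Lemma symp_isometry (V : {group gT}) (V' : {group hT}) :
    symplectic V C b -> symplectic V' C b' -> #|V| = #|V'| ->
  exists f : {morphism V >-> hT},
    isom V V' f /\ {in V &, forall x y, b x y = b' (f x) (f y)}.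
Proof.
move=> sb sb'; suff: #|V| = #|V'| -> exists2 f : {morphism V >-> hT},
    f @* V \subset V' & {in V &, forall x y, b x y = b' (f x) (f y)}.
  move=> ex oV; have [f sf bf] := ex oV; exists f; split=> //.
  exact: symp_preserving_isom.
have [k leVk] := ubnP #|V|; elim: k V V' leVk sb sb' => // k IHk V V' leVk sb sb' oV.
have [V1 | ntV] := eqsVneq V 1.
  have fM : {in V &, {morph (fun=> 1 : hT) : x y / x * y}}.
    by move=> x y _ _; rewrite mulg1.
  exists (Morphism fM); first by apply/subsetP=> _ /morphimP[x _ _ ->]; apply: group1.
  move=> x y; rewrite {1}V1 => /set1P -> Vy /=.
  by rewrite (symp1l sb) // (symp1l sb') ?group1.
have [u Vu nu] := trivgPn _ ntV.
have [v Vv nb] := symp_neq1 sb Vu nu.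
have [u' Vu' nu'] : exists2 u', u' \in V' & u' != 1.
  by apply/trivgPn; rewrite -cardG_gt1 -oV cardG_gt1.
have bC : b u v \in C by case: sb => bC _ _ _ _; apply: bC.
have [v' Vv' bv'] := symp_surj C_pr sb' Vu' nu' bC.
have nb' : b' u' v' != 1 by rewrite bv'.
have nv : v != 1 by apply: contraNneq nb => ->; rewrite (symp1r sb) ?eqxx.
have nv' : v' != 1 by apply: contraNneq nb' => ->; rewrite (symp1r sb') ?eqxx.
have [W [sW dV bWu bWv]] := symp_split C_pr sb Vu Vv nb.
have [W' [sW' dV' bWu' bWv']] := symp_split C_pr sb' Vu' Vv' nb'.
have ou := symp_order C_pr sb Vu nu; have ov := symp_order C_pr sb Vv nv.
have ou' := symp_order C_pr sb' Vu' nu'; have ov' := symp_order C_pr sb' Vv' nv'.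
have [[_ P _ eP] _ _ _] := dprodP dV.
have oP := dprod_card eP; rewrite -!orderE ou ov in oP.
have [[_ P' _ eP'] _ _ _] := dprodP dV'.
have oP' := dprod_card eP'; rewrite -!orderE ou' ov' in oP'.
have oWV := dprod_card dV; have oWV' := dprod_card dV'.
rewrite eP -oP in oWV; rewrite eP' -oP' in oWV'.
have C1 := prime_gt1 C_pr; have C0 := prime_gt0 C_pr.
have oW : #|W| = #|W'|.
  apply/eqP; rewrite -(@eqn_pmul2r (#|C| * #|C|)) ?muln_gt0 ?C0 //.
  by rewrite oWV oWV' oV.
have ltW : #|W| < k.
  rewrite -ltnS (leq_trans _ leVk) // ltnS -oWV.
  by rewrite ltn_Pmulr ?cardG_gt0 // (leq_trans C1) // leq_pmulr.
have [g sgW bg] := IHk W W' ltW sW sW' oW.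
have [/andP[sWV _] _] := dprod_normal2 dV.
have [/andP[sWV' _] _] := dprod_normal2 dV'.
have abV' := symp_abelian C_pr sb'.
have du : #[u'] %| #[u] by rewrite ou ou'.
have dv : #[v'] %| #[v] by rewrite ov ov'.
have sub_cent (A B : {set hT}) : A \subset V' -> B \subset V' -> A \subset 'C(B).
  by move=> sA sB; apply: (centSS sA sB abV').
have cuv : eltm dv @* <[v]> \subset 'C(eltm du @* <[u]>).
  by rewrite !im_eltm sub_cent ?cycle_subG.
(* h sends u to u' and v to v'; f glues it with the isometry g of W. *)
pose h := dprodm_morphism eP cuv.
have sh : h @* P \subset V' by rewrite im_dprodm !im_eltm mul_subG ?cycle_subG.
have chg : h @* P \subset 'C(g @* W).
  by rewrite sub_cent // (subset_trans sgW).
rewrite eP in dV.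
pose f := dprodm_morphism dV chg.
have fE w i j : w \in W -> f (w * (u ^+ i * v ^+ j)) = g w * (u' ^+ i * v' ^+ j).
  move=> Ww; rewrite /f /= dprodmE //.
    by rewrite [h _](dprodmE eP cuv) ?mem_cycle //; congr (_ * (_ * _)); apply: eltmE.
  by rewrite -(dprodW eP) mem_mulg ?mem_cycle.
have decomp x : x \in V -> exists w i j, w \in W /\ x = w * (u ^+ i * v ^+ j).
  rewrite -(dprodW dV) => /mulsgP[w y Ww]; rewrite -(dprodW eP).
  by case/mulsgP=> _ _ /cycleP[i ->] /cycleP[j ->] -> ->; exists w, i, j.
exists f; first by rewrite im_dprodm mul_subG // (subset_trans sgW).
move=> _ _ /decomp[w [i [j [Ww ->]]]] /decomp[x [i' [j' [Wx ->]]]].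
rewrite !fE //.
have [Vw Vx] := (subsetP sWV _ Ww, subsetP sWV _ Wx).
have W'g y : y \in W -> g y \in W'.
  by move=> Wy; apply: (subsetP sgW); apply: mem_morphim.
have [W'w W'x] := (W'g w Ww, W'g x Wx).
rewrite (symp_hyperbolicE sb _ _ _ _ Vu Vv Vw Vx
  (bWu _ Ww) (bWv _ Ww) (bWu _ Wx) (bWv _ Wx)).
have [V'w V'x] := (subsetP sWV' _ W'w, subsetP sWV' _ W'x).
rewrite (symp_hyperbolicE sb' _ _ _ _ Vu' Vv' V'w V'x
  (bWu' _ W'w) (bWv' _ W'w) (bWu' _ W'x) (bWv' _ W'x)).
by rewrite bg // bv'.
Qed.

End Isometry.

Lemma symplectic_comp (gT cT dT : finGroupType) (V : {group gT})
    (C : {group cT}) (D : {group dT}) (b : gT -> gT -> cT)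
    (psi : {morphism C >-> dT}) :
    isom C D psi -> symplectic V C b ->
  symplectic V D (fun x y => psi (b x y)).
Proof.
case/isomP=> psi_inj psiC [bC bMl bMr bxx b_inj]; split=> [x y Vx Vy|x y z Vx Vy Vz
  |x y z Vx Vy Vz|x Vx|x Vx psib1].
- by rewrite -psiC mem_morphim ?bC.
- by rewrite bMl // morphM ?bC.
- by rewrite bMr // morphM ?bC.
- by rewrite bxx // morph1.
apply: b_inj => // y Vy; apply: (injmP psi_inj); rewrite ?bC ?group1 //.
by rewrite morph1 psib1.
Qed.

(** * The commutator form and isoclinism *)

Lemma kappa_symplectic (gT : finGroupType) (G : {group gT}) :
    G^`(1) \subset 'Z(G) ->
  symplectic (G / 'Z(G))%G G^`(1)%G (@kappa gT G).
Proof.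
move=> sG'Z; have liftP a : a \in G / 'Z(G) -> exists2 x, x \in G & a = coset 'Z(G) x.
  by case/morphimP=> x _ Gx ->; exists x.
have cosetGM x y : x \in G -> y \in G ->
    coset 'Z(G) x * coset 'Z(G) y = coset 'Z(G) (x * y).
  by move=> Gx Gy; rewrite morphM // (subsetP (gFnorm _ _)).
split.
- by move=> _ _ /liftP[x Gx ->] /liftP[y Gy ->]; rewrite kappaE ?mem_commg.
- move=> _ _ _ /liftP[x Gx ->] /liftP[y Gy ->] /liftP[z Gz ->].
  by rewrite cosetGM // !kappaE ?groupM // (commgM_der_central sG'Z).
- move=> _ _ _ /liftP[x Gx ->] /liftP[y Gy ->] /liftP[z Gz ->].
  by rewrite cosetGM // !kappaE ?groupM // (commgMr_der_central sG'Z).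
- by move=> _ /liftP[x Gx ->]; rewrite kappaE // commgg.
move=> _ /liftP[x Gx ->] cx; apply: coset_id; apply/centerP; split=> // y Gy.
by apply/commgP/eqP; rewrite -(kappaE Gx Gy); apply/cx/mem_quotient.
Qed.

Lemma isoclinic_index (gT hT : finGroupType) (G : {group gT}) (H : {group hT}) :
  isoclinic G H -> #|G : 'Z(G)| = #|H : 'Z(H)|.
Proof.
case=> phi [_ [iphi _ _]].
by rewrite -!card_quotient ?gFnorm //; apply: isom_card iphi.
Qed.

(** The form of G is first transported to H' along an isomorphism psi of the
    derived subgroups; any psi will do, since the value b u v of a hyperbolic
    pair can be prescribed. *)
Lemma index_isoclinic (gT hT : finGroupType) (G : {group gT}) (H : {group hT}) :
    G^`(1) \subset 'Z(G) -> H^`(1) \subset 'Z(H) ->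
    prime #|G^`(1)| -> #|G^`(1)| = #|H^`(1)| ->
    #|G : 'Z(G)| = #|H : 'Z(H)| ->
  isoclinic G H.
Proof.
move=> sG'Z sH'Z G'_pr oG'H' iGH.
have H'_pr : prime #|H^`(1)| by rewrite -oG'H'.
have /isogP[psi psi_inj psiG'] : G^`(1) \isog H^`(1).
  by rewrite isog_cyclic_card ?prime_cyclic // oG'H' eqxx.
have ipsi : isom G^`(1) H^`(1) psi by apply/isomP.
have sG := symplectic_comp (D := H^`(1)%G) ipsi (kappa_symplectic sG'Z).
have [|phi [iphi phiE]] := symp_isometry H'_pr sG (kappa_symplectic sH'Z).
  by rewrite !card_quotient ?gFnorm.
by exists phi, psi; split.
Qed.

Unset Implicit Arguments.

Theorem theorem7p5 (gT hT : finGroupType) (G : {group gT}) (H : {group hT})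
    (p n m : nat) (p_prime : prime p)
    (pG : p.-group G) (pH : p.-group H)
    (cardG' : #|G^`(1)| = p) (cardH' : #|H^`(1)| = p)
    (indexG : #|G : 'Z(G)| = (p ^ (2 * n))%N)
    (indexH : #|H : 'Z(H)| = (p ^ (2 * m))%N) :
  [/\ [<-> isoclinic G H;
           n = m;
           commuting_prob 2 G = commuting_prob 2 H;
           commuting_prob 3 G = commuting_prob 3 H],
      (n = m <-> #|G : 'Z(G)| = #|H : 'Z(H)|),
      (isoclinic G H ->
        forall r : nat, (2 <= r)%N -> commuting_prob r G = commuting_prob r H),
      (((p ^ (2 * n))%N%:R : rat)
        = (p%:R - 1) / (p%:R * commuting_prob 2 G - 1))%R
    & (((p ^ (2 * n))%N%:R : rat)
        = (p%:R ^+ 3 - 1) / (p%:R ^+ 3 * commuting_prob 3 G - 1))%R].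
Proof.
have sG'Z := pgroup_der_central p_prime pG cardG'.
have sH'Z := pgroup_der_central p_prime pH cardH'.
have dvG' : #|G^`(1)| %| p by rewrite cardG'.
have dvH' : #|H^`(1)| %| p by rewrite cardH'.
have index_inj : #|G : 'Z(G)| = #|H : 'Z(H)| -> n = m.
  rewrite indexG indexH => /(expnI (prime_gt1 p_prime))/eqP.
  by rewrite eqn_pmul2l // => /eqP.
have index_rat_inj : (#|G : 'Z(G)|%g%:R = #|H : 'Z(H)|%g%:R :> rat)%R -> n = m.
  by move/eqP; rewrite Num.Theory.eqr_nat => /eqP/index_inj.
have index_eq : n = m -> #|G : 'Z(G)| = #|H : 'Z(H)|.
  by move=> nm; rewrite indexG indexH nm.
have prob_eq r : n = m -> commuting_prob r G = commuting_prob r H.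
  move/index_eq => iGH.
  by rewrite !(commuting_prob_der_central p_prime) // !center_ratio iGH.
have G2 := index_center_prob2 p_prime sG'Z dvG'.
have H2 := index_center_prob2 p_prime sH'Z dvH'.
have G3 := index_center_prob3 p_prime sG'Z dvG'.
have H3 := index_center_prob3 p_prime sH'Z dvH'.
split.
- tfae.
  + by move/isoclinic_index/index_inj.
  + exact: prob_eq.
  + by move=> P2; apply: prob_eq; apply: index_rat_inj; rewrite G2 H2 P2.
  + move=> P3; apply: index_isoclinic; rewrite ?cardG' ?cardH' //.
    by apply: index_eq; apply: index_rat_inj; rewrite G3 H3 P3.
- by split.
- by move=> /isoclinic_index/index_inj nm r _; apply: prob_eq.
- by rewrite -indexG.
- by rewrite -indexG.
Qed.
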